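(* Let $u\in C^3(0,1)\cap H^1(0,1)$, and suppose that there are real numbers $\mu_\ell$ ($\ell\ge 1$), depending only on the level $\ell$, such that $$u=I_0u+\sum_{\ell=1}^\infty\sum_{i\in\mathcal I_\ell}\mu_\ell\,\phi_{\ell,i}$$ with the series over $\ell$ converging in $H^1(0,1)$. Then $u$ is a quadratic function, i.e. a polynomial of degree at most $2$.
   Context: Let $g:\mathbb R\to\mathbb R$ be the hat function $g(x)=2x$ for $x\in[0,\tfrac12]$, $g(x)=2(1-x)$ for $x\in(\tfrac12,1]$, and $g(x)=0$ otherwise. For $\ell\ge1$ let $h_\ell=2^{-\ell}$, $\mathcal I_\ell=\{i\in\mathbb N: 1\le i\le 2^\ell-1,\ i\text{ odd}\}$, and $\phi_{\ell,i}(x)=g\left(\frac{x-(i-1)h_\ell}{2h_\ell}\right)$, the piecewise linear nodal basis function centered at $x_{\ell,i}=ih_\ell$ on the uniform grid of $[0,1]$ with mesh size $h_\ell$. The function $I_0u(x)=u(0)(1-x)+u(1)x$ is the linear interpolant of $u$ at the endpoints of $[0,1]$, where the boundary values are those of the continuous representative of $u$ on $[0,1]$. *)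

(* Defs.v *)
From HB Require Import structures.
From mathcomp Require Import all_boot all_order all_algebra.
From mathcomp Require Import all_classical all_reals all_analysis.

Set Implicit Arguments.
Unset Strict Implicit.
Unset Printing Implicit Defensive.

Import Order.TTheory GRing.Theory Num.Theory.
Import numFieldNormedType.Exports.

Local Open Scope classical_set_scope.
Local Open Scope ring_scope.

(* Functions on (0,1) are total functions R -> R. None of the predicates on
   functions on (0,1) below depends on the values outside (0,1). *)
Definition I01 {R : realType} : set R := `]0, 1[.

Definition C_on {R : realType} (k : nat) (u : R -> R) : Prop :=
  (forall (j : nat) (x : R), (j < k)%N -> I01 x -> derivable (derive1n j u) x 1) /\
  (forall x : R, I01 x -> {for x, continuous (derive1n k u)}).

(* C_c^oo(0,1), each element being extended by 0 to R. *)
Definition test_function {R : realType} (p : R -> R) : Prop :=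
  [/\ forall (k : nat) (x : R), derivable (derive1n k p) x 1,
      compact (closure [set x | p x != 0])
    & closure [set x | p x != 0] `<=` I01].

(* The restriction [u \_ I01] extends u by 0 outside (0,1). *)
Definition L2 {R : realType} (u : R -> R) : Prop :=
  u \_ I01 \in Lfun lebesgue_measure (2%:E : \bar R).

Definition L2norm {R : realType} (u : R -> R) : \bar R :=
  'N[lebesgue_measure]_(2%:E)[EFin \o (u \_ I01)].

Definition is_weak_deriv {R : realType} (u v : R -> R) : Prop :=
  [/\ locally_integrable I01 u, locally_integrable I01 v
    & forall p : R -> R, test_function p ->
      \int[lebesgue_measure]_(x in I01) (u x * derive1 p x) =
      - \int[lebesgue_measure]_(x in I01) (v x * p x)].

(* Well defined up to equality almost everywhere on (0,1), and junk when u has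
   no weak derivative. *)
Definition weak_deriv {R : realType} (u : R -> R) : R -> R :=
  get [set v : R -> R | is_weak_deriv u v].

Definition H1 {R : realType} (u : R -> R) : Prop :=
  L2 u /\ exists v : R -> R, is_weak_deriv u v /\ L2 v.

Definition H1norm {R : realType} (u : R -> R) : \bar R :=
  ((L2norm u `^ 2 + L2norm (weak_deriv u) `^ 2) `^ 2^-1)%E.

Definition H1_cvg {R : realType} (F : nat -> R -> R) (f : R -> R) : Prop :=
  [/\ forall n, H1 (F n), H1 f & H1norm (F n \- f) @[n --> \oo] --> 0%E].

(* Every element of H^1(0,1) has a continuous representative on [0,1], which is
   unique on [0,1]; outside [0,1] the values of [cont_rep u] are unspecified. *)
Definition cont_rep {R : realType} (u : R -> R) : R -> R :=
  get [set v : R -> R | {within `[0 : R, 1], continuous v} /\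
               {ae lebesgue_measure, forall x, I01 x -> v x = u x}].

Definition I0 {R : realType} (u : R -> R) (x : R) : R :=
  cont_rep u 0 * (1 - x) + cont_rep u 1 * x.

Definition hat {R : realType} (x : R) : R :=
  if 0 <= x <= 2^-1 then 2 * x
  else if 2^-1 < x <= 1 then 2 * (1 - x)
  else 0.

Definition mesh {R : realType} (l : nat) : R := 2 ^- l.

Definition phi {R : realType} (l i : nat) (x : R) : R :=
  hat ((x - (i%:R - 1) * mesh l) / (2 * mesh l)).

Definition hier_sum {R : realType} (mu : nat -> R) (n : nat) (x : R) : R :=
  \sum_(1 <= l < n.+1) \sum_(1 <= i < 2 ^ l | odd i) mu l * phi l i x.

(* Main.v *)
Require Import Defs.
From mathcomp Require Import all_boot all_order all_algebra.
From mathcomp Require Import all_classical all_reals all_analysis measurable_realfun.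
From mathcomp Require Import ring lra.

Import Order.TTheory GRing.Theory Num.Theory.
Import numFieldNormedType.Exports.

Local Open Scope classical_set_scope.
Local Open Scope ring_scope.

(** Write [f] for [u - I0 u], [w_n] for the partial sum of the series up to
    level [n], and [p] for the mesh size of level [m].

    Since the coefficients depend only on the level, level [l] contributes
    [mu_l] times a train of [2^(l-1)] identical hats filling [0,1], a function
    with period [2^(1-l)].  Every level above [m] therefore has period [p], and
    so has [w_n - w_m] for [n >= m] ([hier_tail_periodic]).  Periodicity passes
    to the limit in L2, and for the continuous function [f - w_m] an almost
    everywhere identity holds everywhere on (0,1) ([L2_limit_periodic]).

    On the other hand [w_m] is affine on each dyadic cell of length [p]
    ([hier_sum_affine]), and so is [I0 u].  Hence [u (y + p) - u y] is an affine
    function of [y] while [y] stays in one open cell, and differentiating twice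
    gives [u'' (y + p) = u'' y] there ([derive1_shift_affine]).  So [u''] takes
    the same value at the midpoints of all cells of level [m].  The first
    midpoint [p / 2] serves as a common reference: any two points of (0,1) are
    limits of midpoints as [m] grows, so the continuous function [u''] is
    constant ([eq_of_midcells]) and [u] is quadratic
    ([quadratic_of_derive2_cst]). *)

(** * The hat function and the hierarchical partial sums *)

Lemma hatE {R : realType} (x : R) : hat x = Num.max 0 (1 - `|2 * x - 1|).
Proof.
rewrite /hat; case: ifPn => [/andP[x0 x1]|nl].
  by rewrite ler0_norm ?max_r; lra.
case: ifPn => [/andP[x0 x1]|nr].
  by rewrite ger0_norm ?max_r; lra.
have [x0|x0] := ltP x 0; first by rewrite ler0_norm ?max_l; lra.
have x1 : 1 < x by move: nl nr; rewrite x0 /= -ltNge => -> /=; rewrite ltNge.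
by rewrite ger0_norm ?max_l; lra.
Qed.

Lemma hat_le0 {R : realType} (x : R) : x <= 0 -> hat x = 0.
Proof. by move=> x0; rewrite hatE ler0_norm ?max_l; lra. Qed.

Lemma hat_ge1 {R : realType} (x : R) : 1 <= x -> hat x = 0.
Proof. by move=> x1; rewrite hatE ger0_norm ?max_l; lra. Qed.

Lemma hat_left {R : realType} (x : R) : 0 <= x <= 2^-1 -> hat x = 2 * x.
Proof. by rewrite /hat => ->. Qed.

Lemma hat_right {R : realType} (x : R) : 2^-1 <= x <= 1 -> hat x = 2 * (1 - x).
Proof. by move=> /andP[? ?]; rewrite hatE ger0_norm ?max_r; lra. Qed.

Lemma continuous_hat {R : realType} : continuous (@hat R).
Proof.
rewrite (_ : hat = fun x : R => Num.max 0 (1 - `|2 * x - 1|)); last first.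
  by apply/funext => x; rewrite hatE.
move=> x; apply: (@continuous_max R R (fun=> 0) (fun x => 1 - `|2 * x - 1|)).
  exact: cvg_cst.
apply: cvgB; first exact: cvg_cst.
apply: cvg_norm; apply: cvgB; [exact: mulrl_continuous|exact: cvg_cst].
Qed.

Lemma mesh_gt0 {R : realType} (l : nat) : 0 < mesh l :> R.
Proof. by rewrite invr_gt0 exprn_gt0. Qed.

Lemma mesh_refine {R : realType} (l m : nat) : (l <= m)%N ->
  mesh l = (2 ^ (m - l))%N%:R * mesh m :> R.
Proof.
move=> lm; rewrite /mesh natrX -{2}(subnK lm) exprD invfM mulrA divff ?mul1r//.
Qed.

Lemma continuous_phi {R : realType} (l i : nat) : continuous (@phi R l i).
Proof.
move=> x.
apply: (@continuous_comp _ _ _ (fun x : R => (x - (i%:R - 1) * mesh l) / (2 * mesh l))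
  hat); last exact: continuous_hat.
by apply: cvgM; [apply: cvgB => //; exact: cvg_cst|exact: cvg_cst].
Qed.

Lemma continuous_hier_sum {R : realType} (mu : nat -> R) (n : nat) :
  continuous (hier_sum mu n).
Proof.
move=> x; rewrite /hier_sum.
apply: cvg_big => [|l _]; first exact: add_continuous.
apply: cvg_big => [|i _]; first exact: add_continuous.
by apply: cvgM; [exact: cvg_cst|exact: continuous_phi].
Qed.

(** The odd indices [2k+1] turn a level into a train of translates of one hat
    by the integers, in the variable [2^l x]. *)
Lemma phi_odd {R : realType} (l k : nat) (x : R) :
  phi l.+1 k.*2.+1 x = hat (2 ^+ l * x - k%:R).
Proof.
congr hat; rewrite /mesh exprS -addn1 natrD addrK -muln2 natrM.
by field; rewrite expf_neq0.
Qed.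

Lemma big_nat_odd {V : nmodType} (F : nat -> V) (M : nat) :
  \sum_(1 <= i < M.*2 | odd i) F i = \sum_(k < M) F k.*2.+1.
Proof.
have -> : \sum_(1 <= i < M.*2 | odd i) F i = \sum_(0 <= i < M.*2 | odd i) F i.
  by case: M => [|M]; [rewrite !big_geq|rewrite [RHS]big_ltn_cond].
elim: M => [|M IH]; first by rewrite big_geq// big_ord0.
rewrite big_ord_recr -{}IH doubleS big_mkcond !big_nat_recr//= -big_mkcond.
by rewrite odd_double /= addr0.
Qed.

Lemma level_sumE {R : realType} (l : nat) (x : R) :
  \sum_(1 <= i < 2 ^ l.+1 | odd i) phi l.+1 i x =
  \sum_(k < 2 ^ l) hat (2 ^+ l * x - k%:R).
Proof.
rewrite expnS mul2n big_nat_odd; apply: eq_bigr => k _; exact: phi_odd.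
Qed.

(** A shift by one loses the first hat and gains a last one; both vanish at the
    points considered, which lie in the range [0, K] of the train. *)
Lemma hat_train_shift {R : realType} (K q : nat) (y : R) :
  0 <= y -> y + q%:R <= K%:R ->
  \sum_(k < K) hat (y + q%:R - k%:R) = \sum_(k < K) hat (y - k%:R).
Proof.
elim: q y => [|q IH] y y0 yK; first by under eq_bigr do rewrite addr0.
have yq : y + q%:R + 1 <= K%:R by move: yK; rewrite -natr1; lra.
rewrite -(IH y) //; last by lra.
set z := y + q%:R in yq *.
have z0 : 0 <= z by rewrite addr_ge0.
have -> : y + q.+1%:R = z + 1 by rewrite -natr1 addrA.
case: K yq {yK IH} => [|K] yq; first by rewrite !big_ord0.
rewrite big_ord_recl big_ord_recr /= subr0 hat_ge1 ?lerDr// add0r.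
rewrite (@hat_le0 _ (z - K%:R)) ?addr0; last by move: yq; rewrite -natr1; lra.
by apply: eq_bigr => i _; rewrite /bump /= add1n -natr1; congr hat; lra.
Qed.

(** For a level [l.+1 > m], the shift by [mesh m] is a shift by the integer
    [2^(l-m)] in the variable [2^l x] of the train. *)
Lemma hier_tail_periodic {R : realType} (mu : nat -> R) (m n : nat) (x : R) :
  (m <= n)%N -> 0 <= x -> x + mesh m <= 1 ->
  hier_sum mu n (x + mesh m) - hier_sum mu m (x + mesh m) =
  hier_sum mu n x - hier_sum mu m x.
Proof.
move=> mn x0 x1.
have tail (y : R) : hier_sum mu n y - hier_sum mu m y =
    \sum_(m.+1 <= l < n.+1) mu l * \sum_(1 <= i < 2 ^ l | odd i) phi l i y.
  rewrite /hier_sum (@big_cat_nat _ _ _ m.+1 1 n.+1)//= addrAC subrr add0r.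
  by apply: eq_bigr => l _; rewrite mulr_sumr.
rewrite !tail; apply: eq_big_nat => -[//|l] /andP[]; rewrite ltnS => ml _.
rewrite !level_sumE mulrDr; congr (_ * _).
have shiftE : 2 ^+ l * mesh m = (2 ^ (l - m))%:R :> R.
  by rewrite natrX -{1}(subnK ml) exprD /mesh -mulrA divff ?mulr1// expf_neq0.
rewrite shiftE; apply: hat_train_shift; first by rewrite mulr_ge0// exprn_ge0.
by rewrite -shiftE natrX -mulrDr ler_piMr// exprn_ge0.
Qed.

Definition affine_on {R : realType} (a b : R) (f : R -> R) : Prop :=
  exists A B : R, forall x, a <= x <= b -> f x = A * x + B.

Lemma affine_on_sum {R : realType} (a b : R) (I : eqType) (r : seq I)
    (P : pred I) (F : I -> R -> R) :
  (forall i, i \in r -> P i -> affine_on a b (F i)) ->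
  affine_on a b (fun x => \sum_(i <- r | P i) F i x).
Proof.
elim: r => [|i r IH] Faff.
  by exists 0, 0 => x _; rewrite big_nil mul0r addr0.
have [|A [B AB]] := IH.
  by move=> j jr Pj; apply: Faff => //; rewrite in_cons jr orbT.
have [Pi|/negPf Pi] := boolP (P i); last first.
  by exists A, B => x xab; rewrite big_cons Pi AB.
have [A' [B' AB']] := Faff i (mem_head _ _) Pi.
exists (A' + A), (B' + B) => x xab; rewrite big_cons Pi AB// AB'//; ring.
Qed.

(** The breakpoints of a basis function of level [l <= m] are integer multiples
    of [mesh l], hence of [mesh m], so none lies inside a cell of level [m]. *)
Lemma phi_affine {R : realType} (l m c i : nat) : (l <= m)%N -> (0 < i)%N ->
  affine_on (c%:R * mesh m) (c.+1%:R * mesh m) (@phi R l i).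
Proof.
(* [j], [j.+1] and [j.+2] times [mesh l] are the breakpoints, and [mesh l] is
   [N] cells long: comparing [c] with [j * N], [j.+1 * N] and [j.+2 * N] tells
   which of the four linear pieces contains the cell. *)
case: i => // j lm _; set p : R := mesh m; have p0 : 0 < p := mesh_gt0 m.
pose N := (2 ^ (m - l))%N; have N0 : (0 < N)%N by rewrite expn_gt0.
pose D : R := 2 * mesh l; have D0 : 0 < D by rewrite mulr_gt0// mesh_gt0.
have NE (k : nat) : k%:R * mesh l = (k * N)%N%:R * p.
  by rewrite (mesh_refine l m)// mulrA -natrM.
pose t x := (x - j%:R * mesh l) / D.
have phiE x : phi l j.+1 x = hat (t x) by rewrite /phi -[j.+1]addn1 natrD addrK.
have lep a b : (a <= b)%N -> a%:R * p <= b%:R * p.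
  by move=> ab; rewrite ler_pM2r// ler_nat.
have [A1|B1] := leqP c.+1 (j * N).
  exists 0, 0 => x /andP[_ xc]; rewrite phiE mul0r addr0 hat_le0//.
  by rewrite ler_pdivrMr// mul0r subr_le0 NE (le_trans xc)// lep.
have [A2|B2] := leqP c.+1 (j.+1 * N).
  exists (2 / D), (- (2 / D * (j%:R * mesh l))) => x /andP[cx xc].
  rewrite phiE hat_left; first by rewrite /t; field; rewrite gt_eqF.
  rewrite divr_ge0 ?subr_ge0 ?(ltW D0)//=; last by rewrite NE (le_trans _ cx)// lep.
  rewrite ler_pdivrMr// /D mulKf// lerBlDr -{1}[mesh l]mul1r -mulrDl addrC natr1 NE.
  by rewrite (le_trans xc)// lep.
have [A3|B3] := leqP c.+1 (j.+2 * N).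
  exists (- (2 / D)), (2 + 2 / D * (j%:R * mesh l)) => x /andP[cx xc].
  rewrite phiE hat_right; first by rewrite /t; field; rewrite gt_eqF.
  apply/andP; split.
    rewrite ler_pdivlMr// /D mulKf// lerBrDr -{1}[mesh l]mul1r -mulrDl addrC natr1 NE.
    by rewrite (le_trans _ cx)// lep.
  rewrite ler_pdivrMr// mul1r /D lerBlDr -mulrDl addrC -natrD addn2 NE.
  by rewrite (le_trans xc)// lep.
exists 0, 0 => x /andP[cx _]; rewrite phiE mul0r addr0 hat_ge1//.
rewrite ler_pdivlMr// mul1r /D lerBrDr -mulrDl addrC -natrD addn2 NE.
by rewrite (le_trans _ cx)// lep.
Qed.

Lemma hier_sum_affine {R : realType} (mu : nat -> R) (m c : nat) :
  affine_on (c%:R * mesh m) (c.+1%:R * mesh m) (hier_sum mu m).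
Proof.
apply: affine_on_sum => l; rewrite mem_index_iota ltnS => /andP[_ lm] _.
apply: affine_on_sum => i; rewrite mem_index_iota => /andP[i0 _] _.
have [A [B AB]] := @phi_affine R l m c i lm i0.
by exists (mu l * A), (mu l * B) => x xab; rewrite AB//; ring.
Qed.

(** * Periodicity of limits in L2 *)

Lemma subI01 {R : realType} (a b : R) : 0 < a -> b < 1 ->
  `[a, b]%classic `<=` I01.
Proof.
move=> a0 b1 x; rewrite /I01 /= !in_itv /= => /andP[ax xb].
by rewrite (lt_le_trans a0 ax) (le_lt_trans xb b1).
Qed.

Lemma L2norm_le_H1norm {R : realType} (u : R -> R) : (L2norm u <= H1norm u)%E.
Proof.
have p0 : (0 <= L2norm u)%E := Lnorm_ge0 _ _ _.
rewrite /H1norm; have {1}-> : L2norm u = ((L2norm u `^ 2) `^ 2^-1)%E.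
  by rewrite -poweRrM divff// poweRe1.
apply: (@gt0_ler_poweR R 2^-1) => //.
- by rewrite in_itv /= poweR_ge0 leey.
- by rewrite in_itv /= adde_ge0 ?poweR_ge0 ?leey.
- by rewrite leeDl// poweR_ge0.
Qed.

Lemma integral_sqr_le_L2norm {R : realType} (e : R -> R) (a b : R) :
  {in I01, continuous e} -> 0 < a -> b < 1 ->
  (\int[lebesgue_measure]_(x in `[a, b]) ((e x) ^+ 2)%:E <= L2norm e `^ 2)%E.
Proof.
move=> ce a0 b1; rewrite /L2norm poweR_Lnorm//.
have mI : measurable (I01 : set R) by exact: measurable_itv.
have ab := subI01 a b a0 b1.
have -> : (\int[lebesgue_measure]_x (`|(EFin \o e \_ I01) x| `^ 2))%E =
  (\int[lebesgue_measure]_(x in I01) ((e x) ^+ 2)%:E)%E.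
  rewrite [RHS]integral_mkcond; apply: eq_integral => x _ /=.
  rewrite !patchE; case: ifPn => _ /=.
    by rewrite powR_mulrn ?normr_ge0// real_normK// num_real.
  by rewrite normr0 powR0.
apply: ge0_subset_integral => //; last by move=> x _; rewrite lee_fin sqr_ge0.
apply/measurable_EFinP; apply: measurable_funX.
apply: open_continuous_measurable_fun => //; exact: interval_open.
Qed.

Lemma integral_translate {R : realType} (G : R -> R) (a b p : R) : a <= b ->
  {within `[a + p, b + p], continuous G} ->
  (\int[lebesgue_measure]_(x in `[(a + p)%R, (b + p)%R]) (G x)%:E =
   \int[lebesgue_measure]_(x in `[a, b]) (G (x + p)%R)%:E)%E.
Proof.
move=> ab cG.
have dF : derive1 (fun x : R => x + p) = cst 1.
  by apply/funext => x; rewrite derive1E derive_val addr0.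
rewrite (@integration_by_substitution_increasing _ (fun x => x + p))//.
- by apply: eq_integral => x _; rewrite dF fctE /= mulr1.
- by move=> x y _ _; rewrite ltrD2r.
- by rewrite dF => x _; exact: cst_continuous.
- by rewrite dF; exact: is_cvg_cst.
- by rewrite dF; exact: is_cvg_cst.
- have cF : continuous (fun x : R => x + p).
    by move=> x; apply: cvgD; [exact: cvg_id|exact: cvg_cst].
  split => //.
  + exact: cvg_at_right_filter (cF a).
  + exact: cvg_at_left_filter (cF b).
Qed.

(** A function close to zero in L2 cannot differ much from its translate on a
    whole interval: from [(s - t)^2 <= 2 (s^2 + t^2)] the gap is controlled by
    the squared norms of the function on the interval and on its translate. *)
Lemma L2norm_shift_gap {R : realType} (e : R -> R) (a b p del : R) :
  {in I01, continuous e} -> 0 < a -> a <= b -> 0 <= p -> b + p < 1 -> 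
  (forall x, a <= x <= b -> del <= `|e (x + p) - e x|) -> 0 <= del ->
  ((del ^+ 2 * (b - a))%:E <= 4%:E * L2norm e `^ 2)%E.
Proof.
move=> ce a0 ab p0 bp1 gap del0.
have b1 : b < 1 by apply: le_lt_trans bp1; rewrite lerDl.
have ap0 : 0 < a + p by rewrite ltr_pwDl.
pose e2 x := (e x) ^+ 2.
have ce2 : {in I01, continuous e2}.
  move=> x xI; apply: (@continuous_comp _ _ _ e (fun z => z ^+ 2)).
    exact: ce.
  exact: exprn_continuous.
have cw c d : 0 < c -> d < 1 -> {within `[c, d], continuous e2}.
  move=> c0 d1; apply: continuous_in_subspaceT => x.
  by rewrite inE => /(subI01 c d c0 d1) xI; apply: ce2; rewrite inE.
have mab : measurable (`[a, b]%classic : set R) by exact: measurable_itv.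
have me2 : measurable_fun `[a, b] (EFin \o e2).
  apply/measurable_EFinP.
  exact: subspace_continuous_measurable_fun (cw _ _ _ _).
have me2p : measurable_fun `[a, b] (EFin \o (e2 \o +%R^~ p)).
  apply/measurable_EFinP; apply: subspace_continuous_measurable_fun => //.
  apply: continuous_in_subspaceT => x /[!inE]/= xab.
  apply: continuous_comp.
    by apply: cvgD; [exact: cvg_id|exact: cvg_cst].
  apply: ce2; rewrite inE; apply: (subI01 (a + p) (b + p)) => //=.
  by move: xab; rewrite !in_itv /= !lerD2r.
have e20 x : (0 <= (e2 x)%:E)%E by rewrite lee_fin sqr_ge0.
have -> : (del ^+ 2 * (b - a))%:E =
    (\int[lebesgue_measure]_(x in `[a, b]) (cst (del ^+ 2)%:E x))%E.
  rewrite integral_cst// [X in (_ * X)%E]lebesgue_measure_itv /= lte_fin.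
  have [ltab|ba] := ltP a b; first by rewrite -EFinB.
  by rewrite mule0 (@le_anti _ _ a b) ?ab// subrr mulr0.
apply: (@le_trans _ _ (\int[lebesgue_measure]_(x in `[a, b])
   (2%:E * ((e2 x)%:E + (e2 (x + p)%R)%:E)))%E).
  apply: ge0_le_integral => //.
  - by move=> x _; rewrite lee_fin sqr_ge0.
  - by apply: measurable_funeM; exact: emeasurable_funD.
  - move=> x /=; rewrite in_itv /= => /gap gx.
    rewrite -EFinD -EFinM lee_fin /e2.
    have : del ^+ 2 <= `|e (x + p) - e x| ^+ 2 by rewrite ler_sqr ?nnegrE.
    rewrite real_normK ?num_real// => /le_trans; apply.
    have := sqr_ge0 (e (x + p) + e x); rewrite !expr2; lra.
rewrite ge0_integralZl//; last 2 first.
- exact: emeasurable_funD.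
- by move=> x _; rewrite adde_ge0.
rewrite ge0_integralD// -integral_translate//; last exact: cw.
have -> : 4%:E = (2%:E * 2%:E : \bar R)%E by rewrite -EFinM; congr EFin; lra.
rewrite -muleA; apply: lee_wpmul2l => //.
have -> : (2%:E * L2norm e `^ 2 = L2norm e `^ 2 + L2norm e `^ 2)%E.
  by rewrite -[2]/(1 + 1) EFinD ge0_muleDl// !mul1e.
by apply: leeD; apply: integral_sqr_le_L2norm.
Qed.

(** If [f - v] failed to be periodic at one point, by continuity it would fail
    by a definite amount on an interval.  As [w n - v] is periodic, [w n - f]
    would have the same gap there for all [n >= m], against
    [L2norm_shift_gap]. *)
Lemma L2_limit_periodic {R : realType} (w : nat -> R -> R) (f v : R -> R)
    (m : nat) (p : R) :
  (forall n, {in I01, continuous (w n)}) -> {in I01, continuous f} ->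
  {in I01, continuous v} -> 0 <= p ->
  L2norm (w n \- f) @[n --> \oo] --> 0%E ->
  (forall n x, (m <= n)%N -> 0 < x -> x + p < 1 ->
     w n (x + p) - v (x + p) = w n x - v x) ->
  forall x, 0 < x -> x + p < 1 -> f (x + p) - v (x + p) = f x - v x.
Proof.
move=> cw cf cv p0 wf wper x x0 xp1.
pose g y := (f (y + p) - v (y + p)) - (f y - v y).
apply/eqP; rewrite -subr_eq0 -/(g x); apply/negPn/negP => gx0.
have gN0 : 0 < `|g x| by rewrite normr_gt0.
have xI : I01 x.
  by rewrite /I01 /= in_itv /= x0 /=; apply: le_lt_trans xp1; rewrite lerDl.
have xpI : I01 (x + p) by rewrite /I01 /= in_itv /= xp1 ltr_pwDl.
have cg : {for x, continuous g}.
  have c1 h : {in I01, continuous h} -> h y @[y --> x] --> h x.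
    by move=> ch; apply: ch; rewrite inE.
  have cs h : {in I01, continuous h} -> h (y + p) @[y --> x] --> h (x + p).
    move=> ch; apply: (@cvg_comp _ _ _ (+%R^~ p) h _ (nbhs (x + p))).
      by apply: cvgD; [exact: cvg_id|exact: cvg_cst].
    by apply: ch; rewrite inE.
  apply: cvgB; apply: cvgB; [exact: cs|exact: cs|exact: c1|exact: c1].
pose del := `|g x| / 2; have del0 : 0 < del by rewrite divr_gt0.
have gdel : \forall y \near x, del < `|g y|.
  have : `|g y| @[y --> x] --> `|g x| by apply: cvg_norm.
  by move/cvgr_gt; apply; rewrite /del; lra.
have [r /= r0 rP] : \forall y \near x, del < `|g y| /\ I01 y /\ y + p < 1.
  near=> y; split; first by near: y.
  split; near: y; first exact: open_nbhs_nbhs.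
  near=> y; rewrite -ltrBrDr; near: y.
  by apply: lt_nbhsl; rewrite ltrBrDr.
pose b := x + r / 2.
have bP y : x <= y <= b -> del < `|g y| /\ I01 y /\ y + p < 1.
  move=> /andP[xy yb]; apply: rP; rewrite /= distrC ger0_norm ?subr_ge0//.
  by move: yb; rewrite /b; lra.
have xb : x < b by rewrite /b; lra.
have [_ [_ bp1]] : del < `|g b| /\ I01 b /\ b + p < 1 by apply: bP; rewrite ltW//=.
have small : (\forall n \near \oo, L2norm (w n \- f)%R `^ 2 < (del ^+ 2 * (b - x) / 4)%:E)%E.
  pose k := del ^+ 2 * (b - x) / 4.
  have k0 : 0 < k by rewrite divr_gt0// mulr_gt0 ?exprn_gt0 ?subr_gt0.
  have s0 : 0 < Num.sqrt k by rewrite sqrtr_gt0.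
  have : (\forall n \near \oo, L2norm (w n \- f)%R < (Num.sqrt k)%:E)%E.
    move/fine_cvgP: wf => [wfin /cvgr_lt /(_ _ s0)]; apply: filterS2 wfin => n.
    by move=> /fineK <- /=; rewrite lte_fin.
  apply: filterS => n; have := Lnorm_ge0 lebesgue_measure 2%:E (EFin \o ((w n \- f) \_ I01)).
  rewrite -/(L2norm _); case: (L2norm _) => // z; rewrite lee_fin lte_fin => z0 zk.
  rewrite poweR_EFin lte_fin powR_mulrn// -/k -[ltRHS]sqr_sqrtr ?ltW//.
  by rewrite ltr_sqr ?nnegrE ?sqrtr_ge0.
near \oo => n.
have mn : (m <= n)%N by near: n; exists m.
have : (L2norm (w n \- f)%R `^ 2 < (del ^+ 2 * (b - x) / 4)%:E)%E by near: n.
apply/negP; rewrite -leNgt.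
have ce : {in I01, continuous (w n \- f)}.
  by move=> y yI; apply: cvgB; [exact: cw|exact: cf].
have gape y : x <= y <= b -> del <= `|(w n \- f) (y + p) - (w n \- f) y|.
  move=> yb; have [gy [yI yp1]] := bP y yb.
  have y0 : 0 < y by move: yI; rewrite /I01 /= in_itv /= => /andP[].
  have wE := wper n y mn y0 yp1.
  rewrite ltW// (lt_le_trans gy)// -normrN le_eqVlt; apply/orP; left; apply/eqP.
  by congr `|_|; rewrite /g /=; lra.
have := L2norm_shift_gap _ x b p del ce x0 (ltW xb) p0 bp1 gape (ltW del0).
move: (poweR_ge0 (L2norm (w n \- f)) 2); case: (_ `^ 2)%E => //= z _.
  rewrite -EFinM !lee_fin => ?; lra.
by rewrite leey.
Unshelve. all: by end_near. Qed.

(** * Second derivatives *)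

Lemma eq_on_I01_of_derive0 {R : realType} (f : R -> R) :
  (forall x, I01 x -> is_derive x 1 f 0) ->
  forall x y, I01 x -> I01 y -> f x = f y.
Proof.
move=> f0.
suff lt_case x y : I01 x -> I01 y -> x < y -> f x = f y.
  move=> x y xI yI; have [/lt_case->|/lt_case->|->] := ltgtP x y => //.
rewrite /I01 /= !in_itv /= => /andP[x0 x1] /andP[y0 y1] xy.
have sub z : x <= z <= y -> I01 z.
  by move=> /andP[xz zy]; rewrite /I01 /= in_itv /= (lt_le_trans x0) ?(le_lt_trans zy).
have fxy z : z \in `]x, y[%R -> is_derive z 1 f 0.
  by rewrite in_itv /= => /andP[xz zy]; apply/f0/sub; rewrite (ltW xz) (ltW zy).
have fc : {within `[x, y], continuous f}.
  apply: derivable_within_continuous => z; rewrite in_itv /= => /sub zI.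
  by have [] := f0 z zI.
have [z _] := @MVT R f (fun=> 0) x y xy fxy fc.
by rewrite mul0r => /eqP; rewrite subr_eq0 => /eqP ->.
Qed.

Lemma quadratic_of_derive2_cst {R : realType} (u : R -> R) (K : R) :
  (forall x, I01 x -> derivable u x 1) ->
  (forall x, I01 x -> derivable (derive1 u) x 1) ->
  (forall x, I01 x -> derive1 (derive1 u) x = K) ->
  exists p : {poly R}, (size p <= 3)%N /\ (forall x : R, I01 x -> u x = p.[x]).
Proof.
move=> du ddu d2u; pose h : R := 2^-1.
have hI : I01 h by rewrite /I01 /= in_itv /= /h; lra.
pose B := derive1 u h - K * h.
have u1 x : I01 x -> derive1 u x = K * x + B.
  move=> xI; pose g y := derive1 u y - K * y.
  have g0 y : I01 y -> is_derive y 1 g 0.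
    move=> yI; have dy : is_derive y 1 (derive1 u) K.
      by rewrite -(d2u y yI) derive1E; exact/derivableP/ddu.
    by apply: is_derive_eq; rewrite /GRing.scale /= mulr1 subrr.
  have -> : B = g x by exact: (eq_on_I01_of_derive0 g g0).
  by rewrite /g addrC subrK.
pose C := u h - K / 2 * h ^+ 2 - B * h.
exists (C%:P + B *: 'X + (K / 2) *: 'X^2); split.
  rewrite (leq_trans (size_polyD _ _))// geq_max; apply/andP; split.
    rewrite (leq_trans (size_polyD _ _))// geq_max size_polyC.
    rewrite (leq_trans (size_scale_leq _ _)) ?size_polyX// andbT.
    by case: (C != 0).
  by rewrite (leq_trans (size_scale_leq _ _)) ?size_polyXn.
move=> x xI; rewrite !hornerD !hornerZ hornerC hornerX hornerXn.
pose g y := u y - K / 2 * y ^+ 2 - B * y.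
have g0 y : I01 y -> is_derive y 1 g 0.
  move=> yI; have dy : is_derive y 1 u (K * y + B).
    by rewrite -(u1 y yI) derive1E; exact/derivableP/du.
  apply: is_derive_eq; rewrite /GRing.scale /= !mulr1; lra.
have -> : C = g x by exact: (eq_on_I01_of_derive0 g g0).
by rewrite /g; ring.
Qed.

(** The conclusion is again an affine relation, with slope [0], between the
    derivative and its translate, so the lemma can be applied a second time. *)
Lemma derive1_shift_affine {R : realType} (v : R -> R) (a b p A B : R) :
  (forall y, a < y < b -> derivable v y 1 /\ derivable v (y + p) 1) ->
  (forall y, a < y < b -> v (y + p) = v y + A * y + B) ->
  forall y, a < y < b -> derive1 v (y + p) = derive1 v y + A.
Proof.
move=> dv vE y yab; have [dvy dvyp] := dv y yab.
have d1 : is_derive (y + p) 1 v (derive1 v (y + p)).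
  by rewrite derive1E; exact/derivableP.
have d2 : is_derive y 1 v (derive1 v y).
  by rewrite derive1E; exact/derivableP.
have ds : is_derive y 1 (fun z : R => z + p) 1.
  by apply: is_derive_eq; rewrite addr0.
have L : is_derive y 1 (v \o (fun z => z + p)) (derive1 v (y + p)).
  by rewrite -[derive1 v (y + p)]mulr1; exact: is_derive1_comp.
have Rh : is_derive y 1 (fun z => v z + A * z + B) (derive1 v y + A).
  by apply: is_derive_eq; rewrite /GRing.scale /= mulr1 addr0.
have [_ <-] := L; have [_ <-] := Rh.
apply: near_eq_derive; near=> z; apply: vE.
near: z; have : nbhs y `]a, b[%classic.
  apply: open_nbhs_nbhs; split; first exact: interval_open.
  by rewrite /= in_itv.
by apply: filterS => z; rewrite /= in_itv.
Unshelve. all: by end_near. Qed.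

Definition midcell {R : realType} (m c : nat) : R := (c%:R + 2^-1) * mesh m.

Lemma midcell_itv {R : realType} (m c : nat) :
  c%:R * mesh m < @midcell R m c < c.+1%:R * mesh m.
Proof.
rewrite /midcell !ltr_pM2r ?mesh_gt0// -[c.+1%:R]natr1; lra.
Qed.

Lemma cell_sub01 {R : realType} (m c : nat) (y : R) : (c < 2 ^ m)%N ->
  c%:R * mesh m < y < c.+1%:R * mesh m -> I01 y.
Proof.
move=> cm /andP[cy yc]; rewrite /I01 /= in_itv /=; apply/andP; split.
  by apply: le_lt_trans cy; rewrite mulr_ge0// ltW// mesh_gt0.
apply: lt_le_trans yc _.
by rewrite ler_pdivrMr ?exprn_gt0// mul1r -natrX ler_nat.
Qed.

(** Each point of (0,1) is the limit of the midpoints of the dyadic cells that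
    contain it, and along these midpoints [F] runs through a sequence that does
    not depend on the point. *)
Lemma eq_of_midcells {R : realType} (F : R -> R) :
  {in I01, continuous F} ->
  (forall m c, (c < 2 ^ m)%N -> F (midcell m c) = F (midcell m 0)) ->
  forall x y, I01 x -> I01 y -> F x = F y.
Proof.
move=> cF Fmid x y xI yI.
have mesh0 : mesh m @[m --> \oo] --> (0 : R).
  rewrite (_ : (fun m => mesh m) = GRing.exp (2^-1 : R)); last first.
    by apply/funext => m; rewrite /mesh -exprVn.
  by apply: cvg_expr; rewrite ger0_norm// invf_lt1// ltr1n.
suff lim z : I01 z -> F (midcell m 0) @[m --> \oo] --> F z.
  exact: (cvg_unique _ (lim x xI) (lim y yI)).
move=> zI; pose c m := Num.truncn (z * 2 ^+ m).
have /andP[z0 z1] : 0 < z < 1 by move: zI; rewrite /I01 /= in_itv.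
have e0 m : 0 < 2 ^+ m :> R by rewrite exprn_gt0.
have cP m : (c m)%:R * mesh m <= z < (c m).+1%:R * mesh m.
  rewrite /mesh ler_pdivrMr// ltr_pdivlMr//.
  by apply: truncn_itv; rewrite mulr_ge0// ltW.
have cm m : (c m < 2 ^ m)%N.
  rewrite -(ltr_nat R) natrX -(ltr_pM2r (mesh_gt0 m)) [ltRHS]mulfV ?gt_eqF//.
  by apply: le_lt_trans z1; have /andP[] := cP m.
have cz : midcell m (c m) @[m --> \oo] --> z.
  apply: (@squeeze_cvgr _ _ _ _ (fun m => z - mesh m) (fun m => z + mesh m)).
  - apply: nearW => m; have /andP[] := cP m; have /andP[] := @midcell_itv R m (c m).
    rewrite -natr1 mulrDl mul1r => H1 H2 H3 H4.
    by rewrite lerBlDr; apply/andP; split; lra.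
  - by rewrite -[X in _ --> X]subr0; apply: cvgB => //; exact: cvg_cst.
  - by rewrite -[X in _ --> X]addr0; apply: cvgD => //; exact: cvg_cst.
have : F (midcell m (c m)) @[m --> \oo] --> F z.
  by apply: (cvg_comp _ _ cz); apply: cF; rewrite inE.
by rewrite (_ : (fun m => F (midcell m (c m))) = fun m => F (midcell m 0))//;
  apply/funext => m; exact: Fmid.
Qed.

(** * The main result *)

Theorem theorem3p2 (R : realType) (u : R -> R) (mu : nat -> R)
    (u_C3 : C_on 3 u) (u_H1 : H1 u)
    (u_series : H1_cvg (hier_sum mu) (fun x => u x - I0 u x)) :
  exists p : {poly R}, (size p <= 3)%N /\ (forall x : R, I01 x -> u x = p.[x]).
Proof.
have [du _] := u_C3; have [_ _ uS] := u_series.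
have du0 x : I01 x -> derivable u x 1 by exact: (du 0).
have du1 x : I01 x -> derivable (derive1 u) x 1 by exact: (du 1).
have du2 x : I01 x -> derivable (derive1 (derive1 u)) x 1 by exact: (du 2).
have cont_of_deriv (h : R -> R) :
    (forall x, I01 x -> derivable h x 1) -> {in I01, continuous h}.
  move=> dh x; rewrite inE => /dh; rewrite derivable1_diffP.
  exact: differentiable_continuous.
pose f x := u x - I0 u x.
have cf : {in I01, continuous f}.
  move=> x xI; apply: cvgB; first exact: cont_of_deriv.
  rewrite /I0; apply: cvgD.
    apply: cvgM; first exact: cvg_cst.
    by apply: cvgB; [exact: cvg_cst|exact: cvg_id].
  by apply: cvgM; [exact: cvg_cst|exact: cvg_id].
have L2S : L2norm (hier_sum mu n \- f) @[n --> \oo] --> 0%E.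
  apply: (@squeeze_cvge _ _ _ _ (fun=> 0%E) _
    (fun n => H1norm (hier_sum mu n \- f))) => //.
  - by apply: nearW => n; rewrite L2norm_le_H1norm andbT Lnorm_ge0.
  - exact: cvg_cst.
have per m x : 0 < x -> x + mesh m < 1 ->
    f (x + mesh m) - hier_sum mu m (x + mesh m) = f x - hier_sum mu m x.
  apply: (L2_limit_periodic (hier_sum mu) f _ m) => //.
  - by move=> n y _; exact: continuous_hier_sum.
  - by move=> y _; exact: continuous_hier_sum.
  - by rewrite ltW// mesh_gt0.
  - move=> n y mn y0 y1; apply: hier_tail_periodic => //; exact: ltW.
(* The cells [c] and [c.+1] are open and adjacent, the second being the
   translate of the first by [p]. *)
have d2_next m c : (c.+1 < 2 ^ m)%N ->
    derive1 (derive1 u) (midcell m c.+1) = derive1 (derive1 u) (midcell m c).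
  move=> cm; set p : R := mesh m.
  have nextE (k : nat) : k.+1%:R * p = k%:R * p + p by rewrite -natr1 mulrDl mul1r.
  have -> : midcell m c.+1 = midcell m c + p by rewrite /midcell -/p -natr1; ring.
  pose a := c%:R * p; pose b := c.+1%:R * p.
  have cell y : a < y < b -> I01 y by apply: cell_sub01; exact: ltnW.
  have cellp y : a < y < b -> I01 (y + p).
    move=> yab; apply: (@cell_sub01 _ m c.+1) => //.
    by rewrite -/p !nextE !ltrD2r -nextE.
  (* On the cell, [w_m] has slope [A]; on the next one, slope [A']. *)
  have [A [B wE]] := @hier_sum_affine R mu m c.
  have [A' [B' wE']] := @hier_sum_affine R mu m c.+1.
  have uE y : a < y < b -> u (y + p) = u y +
      (A' - A) * y + (A' * p + B' - B + (cont_rep u 1 - cont_rep u 0) * p).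
    move=> yab; have yI := cell y yab; have ypI := cellp y yab.
    have y0 : 0 < y by move: yI; rewrite /I01 /= in_itv /= => /andP[].
    have yp1 : y + p < 1 by move: ypI; rewrite /I01 /= in_itv /= => /andP[].
    have := per m y y0 yp1; rewrite -/p (wE y); last first.
      by move: yab => /andP[ay yb]; apply/andP; split; exact: ltW.
    rewrite (wE' (y + p)); last first.
      move: yab => /andP[ay yb]; rewrite -/p !nextE !lerD2r -nextE.
      by apply/andP; split; exact: ltW.
    by rewrite /f /I0; lra.
  have mid : a < midcell m c < b := midcell_itv m c.
  rewrite (derive1_shift_affine (derive1 u) a b p 0 (A' - A))//.
  - by rewrite addr0.
  - by move=> y yab; split; [exact: du1 (cell y yab)|exact: du1 (cellp y yab)].
  - move=> y yab; rewrite mul0r addr0.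
    apply: (derive1_shift_affine u a b p _ _ _ uE) => // z zab.
    by split; [exact: du0 (cell z zab)|exact: du0 (cellp z zab)].
have mids m c : (c < 2 ^ m)%N ->
    derive1 (derive1 u) (midcell m c) = derive1 (derive1 u) (midcell m 0).
  by elim: c => [_|c IH cm]; [reflexivity|rewrite (d2_next m c cm); exact/IH/ltnW].
have h01 : I01 (2^-1 : R) by rewrite /I01 /= in_itv /=; lra.
have d2_cst x : I01 x -> derive1 (derive1 u) x = derive1 (derive1 u) 2^-1.
  move=> xI.
  exact: (eq_of_midcells (derive1 (derive1 u)) (cont_of_deriv _ du2) mids _ _ xI h01).
exact: (quadratic_of_derive2_cst u _ du0 du1 d2_cst).
Qed.
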